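(* Let $D$ be the degree sequence of a tree and let $r$ be a positive integer. Then the greedy tree $\mathcal G(D)$ attains the minimum of the Steiner $r$-Wiener index among all trees with degree sequence $D$: for every tree $T$ with degree sequence $D$, $\mathrm{SW}_r(T)\ge \mathrm{SW}_r(\mathcal G(D))$.
   Context: For a tree $T$ and a set $\{v_1,\dots,v_r\}$ of $r$ vertices, the Steiner distance $\mathrm{sd}(v_1,\dots,v_r)$ is the number of edges of the smallest subtree of $T$ containing $v_1,\dots,v_r$. The Steiner $r$-Wiener index is $\mathrm{SW}_r(T)=\sum_{\{v_1,\dots,v_r\}\subseteq V(T)}\mathrm{sd}(v_1,\dots,v_r)$, the sum being over all $r$-element subsets of $V(T)$. Degree sequences are written in non-increasing order. Greedy tree $\mathcal G(D)$: start with a root $v$ that is assigned the largest degree in $D$. Give $v$ its neighbours $v_1,\dots,v_{d(v)}$ and assign to them the largest available degrees with $d(v_1)\ge d(v_2)\ge\cdots$. Then give $v_1$ its remaining neighbours and assign to them the largest available degrees in non-increasing order; then do the same for $v_2$, $v_3$, etc. Continue in this way, always continuing with the labelled vertex of largest degree whose neighbours are not yet labelled (equivalently, process vertices in breadth-first order, in the order in which they were labelled, always assigning the largest remaining degrees). *)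

(* Defs.v *)
From HB Require Import structures.
From mathcomp Require Import all_boot.

Set Implicit Arguments.
Unset Strict Implicit.
Unset Printing Implicit Defensive.

(* Finite simple graphs whose vertices lie in V.  The vertex set is an arbitrary
   subset of V, so that a graph and its subgraphs have the same type. *)
Definition simple_edges (V : finType) (g : {set V} * {set {set V}}) : bool :=
  [forall f in g.2, (#|f| == 2) && (f \subset g.1)].

Record graph (V : finType) := Graph {
  graph_val : {set V} * {set {set V}};
  graph_valP : simple_edges graph_val
}.

HB.instance Definition _ (V : finType) := [isSub for @graph_val V].
HB.instance Definition _ (V : finType) := [Finite of graph V by <:].

Section GraphNotions.

Variable V : finType.
Implicit Types (G H : graph V) (S : {set V}).

Definition verts G : {set V} := (graph_val G).1.
Definition edges G : {set {set V}} := (graph_val G).2.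

Definition adj G : rel V := fun x y => [set x; y] \in edges G.

Definition degree G (x : V) : nat := #|[set y | adj G x y]|.

Definition degree_seq G : seq nat :=
  sort geq [seq degree G x | x <- enum (verts G)].

Definition connected G : bool :=
  (verts G != set0) &&
  [forall x in verts G, forall y in verts G, connect (adj G) x y].

(* A list without repetition has at most #|V| elements, so bounding the length
   of the cycles loses nothing (acyclicP) and keeps the predicate boolean.
   An edge xy yields the ucycle [:: x; y], which is not a cycle of the graph. *)
Definition acyclic G : bool :=
  [forall n : 'I_#|V|.+1, forall c : n.-tuple V,
     ucycleb (adj G) c ==> (n <= 2)].

Lemma acyclicP G :
  reflect (forall c : seq V, ucycle (adj G) c -> size c <= 2) (acyclic G).
Proof.
apply: (iffP idP) => [aG c cC|aG].
  have sz : size c < #|V|.+1.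
    by case/andP: cC => _ uc; rewrite ltnS -(card_uniqP uc) max_card.
  have /forallP/(_ (Ordinal sz))/forallP/(_ (in_tuple c))/implyP := aG.
  exact.
apply/forallP => n; apply/forallP => c; apply/implyP => cC.
by rewrite -[X in X <= 2](size_tuple c); apply: aG.
Qed.

Definition is_tree G : bool := connected G && acyclic G.

Definition subgraph H G : bool :=
  (verts H \subset verts G) && (edges H \subset edges G).

(* When G is a tree and S is a set of its vertices, the seed G of the arg min
   satisfies the constraint, so this is a genuine minimum. *)
Definition steiner_dist G S : nat :=
  #|edges [arg min_(H < G | [&& subgraph H G, is_tree H & S \subset verts H])
             #|edges H| ]|.

Definition steiner_wiener (r : nat) G : nat :=
  \sum_(S : {set V} | (S \subset verts G) && (#|S| == r)) steiner_dist G S.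

Definition rel_edges (e : rel V) : {set {set V}} :=
  [set [set p.1; p.2] | p in [pred p : V * V | (p.1 != p.2) && e p.1 p.2]].

Lemma rel_edges_simple (e : rel V) : simple_edges ([set: V], rel_edges e).
Proof.
apply/forall_inP => f /imsetP[[x y] /andP[/= nxy _] ->].
by rewrite cards2 nxy subsetT.
Qed.

Definition rel_graph (e : rel V) : graph V := Graph (rel_edges_simple e).

End GraphNotions.

(* The vertices of the greedy tree are numbered in the order in which they are
   labelled.  As D is non-increasing and the largest remaining degrees are always
   assigned first, vertex i is assigned the degree D_i; the vertices are then
   processed in the order 0, 1, 2, ...
   num_labelled D i is the number of vertices already labelled when vertex i is
   about to be processed: processing the root 0 labels D_0 new vertices, and
   processing k > 0, which already has one neighbour, labels D_k - 1. *)
Fixpoint num_labelled (D : seq nat) (i : nat) : nat :=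
  if i is k.+1 then num_labelled D k + (nth 0 D k - (0 < k)) else 1.

Definition greedy_child (D : seq nat) (i j : nat) : bool :=
  num_labelled D i <= j < num_labelled D i.+1.

Definition greedy_tree (D : seq nat) : graph 'I_(size D) :=
  rel_graph (fun i j : 'I_(size D) => greedy_child D i j).

(* Main.v *)
(** Root a tree of order n and let s_v be the number of descendants of v (v
    included).  An edge lies in the Steiner tree of S iff it separates S, so
    SW_r is the sum over the non-root vertices v of
      C(n,r) - C(s_v,r) - C(n-s_v,r),
    a concave function of s_v that is non-decreasing as long as s_v <= n/2.

    Let U be a set of j >= 1 vertices, closed under taking parents.  The sum of
    s_v over the vertices outside U is the sum over k of n - |A_k|, where A_0 = U
    and A_{k+1} consists of the root and the children of A_k.  Since A_k contains
    the root, |A_{k+1}| <= num_labelled D |A_k|, with equality throughout in the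
    greedy tree when U consists of the first j vertices.  Hence if T is rooted at
    a centroid and its vertices are listed by decreasing s_v, then all the suffix
    sums of this list dominate those of the greedy tree in its labelling order.
    The supporting lines of the concave function at the values s_v of T have
    non-negative slopes, which increase along the list, and Abel summation
    concludes. *)

Require Import Defs.
From mathcomp Require Import all_boot zify.

Set Implicit Arguments.
Unset Strict Implicit.
Unset Printing Implicit Defensive.

(** * Rooted trees given by a parent map *)

(* dep only serves to make iteration of p terminate at rho: it will be the distance
   to rho in an arbitrary tree, and the label of the vertex in the greedy tree. *)
Definition rooted (V : finType) (G : graph V) (rho : V) (p : V -> V)
    (dep : V -> nat) : Prop :=
  [/\ rho \in verts G,
      forall v, v \in verts G -> v != rho -> p v \in verts G /\ dep (p v) < dep v
    & edges G = [set [set v; p v] | v in verts G :\ rho]].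

(** [rooted] leaves [p rho] arbitrary, so the guard is what makes every climb end at the root. *)
Definition up (V : finType) (rho : V) (p : V -> V) : rel V :=
  fun x y => (x != rho) && (y == p x).

Definition desc (V : finType) (G : graph V) (rho : V) (p : V -> V) (v : V) : {set V} :=
  [set w in verts G | connect (up rho p) w v].

Lemma eq_set2 (V : finType) (a b c d : V) :
  [set a; b] = [set c; d] -> (a = c /\ b = d) \/ (a = d /\ b = c).
Proof.
move=> /setP e.
move: (e a) (e b) (e c) (e d); rewrite !inE !eqxx ?orbT /=.
move=> /esym/orP ha /esym/orP hb /orP hc /orP hd.
by case: ha => /eqP ha; case: hb => /eqP hb; subst; auto;
  case: hc => /eqP hc; case: hd => /eqP hd; subst; auto.
Qed.

Section Rooted.

Variables (V : finType) (G : graph V) (rho : V) (p : V -> V) (dep : V -> nat).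
Hypothesis rG : rooted G rho p dep.

Local Notation desc := (desc G rho p).
Local Notation n := #|verts G|.

Lemma rooted_root : rho \in verts G. Proof. by case: rG. Qed.

Lemma card_nonroot : #|verts G :\ rho| = n.-1.
Proof. by rewrite (cardsD1 rho (verts G)) rooted_root. Qed.

Lemma rooted_parent v : v \in verts G -> v != rho -> p v \in verts G.
Proof. by case: rG => _ h _ hv vr; case: (h v hv vr). Qed.

Lemma rooted_dep v : v \in verts G -> v != rho -> dep (p v) < dep v.
Proof. by case: rG => _ h _ hv vr; case: (h v hv vr). Qed.

Lemma rooted_edge v : v \in verts G -> v != rho -> [set v; p v] \in edges G.
Proof.
by case: rG => _ _ -> hv vr; apply/imsetP; exists v; rewrite ?inE ?vr.
Qed.

Lemma rooted_edgeP e : reflect (exists v, [/\ v \in verts G, v != rho & e = [set v; p v]])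
  (e \in edges G).
Proof.
case: rG => _ _ ->; apply: (iffP imsetP) => [[v]|[v [hv vr ->]]].
  by rewrite !inE => /andP[vr hv] ->; exists v.
by exists v; rewrite // !inE vr.
Qed.

Lemma adj_sym : symmetric (adj G).
Proof. by move=> x y; rewrite /adj setUC. Qed.

Lemma rooted_adjP x y : reflect
  ([/\ x \in verts G, x != rho & y = p x] \/ [/\ y \in verts G, y != rho & x = p y])
  (adj G x y).
Proof.
apply: (iffP (rooted_edgeP _)) => [[v [hv vr]]|].
  by case/eq_set2 => -[-> ->]; [left|right].
case=> -[hv vr ->]; first by exists x.
by exists y; rewrite setUC.
Qed.

Lemma rooted_vertex_ind (P : V -> Prop) :
  P rho -> (forall v, v \in verts G -> v != rho -> P (p v) -> P v) ->
  forall v, v \in verts G -> P v.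
Proof.
move=> P0 PS v; elim: {v}_.+1 {-2}v (ltnSn (dep v)) => // m IH v hm hv.
have [->//|vr] := eqVneq v rho.
apply: PS => //; apply: IH; last exact: rooted_parent.
by have := rooted_dep hv vr; lia.
Qed.

Lemma rooted_connected : connected G.
Proof.
apply/andP; split; first by apply/set0Pn; exists rho; exact: rooted_root.
have C : forall v, v \in verts G -> connect (adj G) v rho.
  apply: rooted_vertex_ind => // v hv vr; apply: connect_trans.
  by apply: connect1; apply/rooted_adjP; left.
apply/forall_inP => x hx; apply/forall_inP => y hy.
apply: (connect_trans (C x hx)).
by rewrite (sym_connect_sym adj_sym); exact: C.
Qed.

(** On a cycle, a vertex of maximal [dep] can only be adjacent to its own parent, so its two
    neighbours on the cycle coincide. *)
Lemma rooted_acyclic : acyclic G.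
Proof.
apply/acyclicP => c /andP[cC uC]; rewrite leqNgt; apply/negP => sz.
have [x0 hx0] : exists x, x \in c by case: c sz {cC uC} => // a c _; exists a; rewrite inE eqxx.
have [x xc xmax] := @arg_maxnP V x0 (fun x => x \in c) dep hx0.
have [i c' ei] := rot_to xc.
move: cC uC sz xmax; rewrite -(rot_cycle i) -(rot_uniq i) -(size_rot i) ei.
move=> cC uC sz xmax.
have {}xmax y : y \in x :: c' -> dep y <= dep x by rewrite -ei mem_rot; apply: xmax.
have par y : y \in x :: c' -> adj G x y -> y = p x.
  move=> yc /rooted_adjP[[]//|[hy yr ex]].
  by have := rooted_dep hy yr; have := xmax y yc; rewrite -ex; lia.
case: c' {ei} cC uC sz xmax par => [|y c'] //=.
case/lastP: c' => [|c' z] //=.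
rewrite rcons_path last_rcons => /and3P[xy _ zx].
move=> uC _ xmax par.
have ey : y = p x by apply: par; rewrite ?inE ?eqxx ?orbT.
have ez : z = p x.
  by apply: par; [rewrite !inE mem_rcons inE eqxx !orbT|rewrite adj_sym].
have ez' : y = z by rewrite ey ez.
by move: uC => /and3P[_ + _]; rewrite ez' mem_rcons inE eqxx.
Qed.

Lemma rooted_is_tree : is_tree G.
Proof. by rewrite /is_tree rooted_connected rooted_acyclic. Qed.

Lemma desc_sub v : desc v \subset verts G.
Proof. by apply/subsetP => w; rewrite inE => /andP[]. Qed.

Lemma desc_refl v : v \in verts G -> v \in desc v.
Proof. by move=> hv; rewrite inE hv connect0. Qed.

Lemma desc_root : desc rho = verts G.
Proof.
apply/eqP; rewrite eqEsubset desc_sub; apply/subsetP => w hw; rewrite inE hw /=.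
move: w hw; apply: rooted_vertex_ind => // v hv vr; apply: connect_trans.
by apply: connect1; rewrite /up vr eqxx.
Qed.

Lemma desc_step v w : w \in verts G -> w != v ->
  (w \in desc v) = (w != rho) && (p w \in desc v).
Proof.
move=> hw wv; apply/idP/andP => [|[wr]]; rewrite !inE.
  case/andP=> _ /connectP[[|y q] /=]; first by move=> _ e; rewrite e eqxx in wv.
  case/andP=> /andP[wr /eqP ->] pq e; rewrite wr rooted_parent //; split=> //=.
  by apply/connectP; exists q.
case/andP=> _; rewrite hw; apply: connect_trans; apply: connect1.
by rewrite /up wr eqxx.
Qed.

Lemma desc_parent v w : w \in verts G -> w != rho -> p w \in desc v -> w \in desc v.
Proof.
move=> hw wr pw; have [<-|wv] := eqVneq w v; last by rewrite desc_step // wr.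
exact: desc_refl.
Qed.

Lemma desc_trans u v w : u \in desc v -> v \in desc w -> u \in desc w.
Proof.
by rewrite !inE => /andP[-> uv] /andP[_ vw]; apply: connect_trans uv vw.
Qed.

Lemma desc_dep v w : w \in desc v -> w = v \/ dep v < dep w.
Proof.
move=> hw; have /(subsetP (desc_sub v)) := hw.
move=> wG; move: w wG hw; apply: rooted_vertex_ind.
  case: (eqVneq rho v) => [<-|rv]; first by left.
  by rewrite desc_step ?rooted_root // eqxx.
move=> w hw wr IH; have [->|wv] := eqVneq w v; first by left.
rewrite desc_step // => /andP[_ /IH h]; have d := rooted_dep hw wr; right.
by case: h => [<-//|]; lia.
Qed.

(** Climbing from the common descendant [w], the first of [u] and [v] to be met is a descendant of
    the other. *)
Lemma desc_laminar u v w : w \in desc u -> w \in desc v -> u \in desc v \/ v \in desc u.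
Proof.
move=> hw; have /(subsetP (desc_sub u)) := hw.
move=> wG; move: w wG hw; apply: rooted_vertex_ind.
  case: (eqVneq rho u) => [<-|ru]; last by rewrite desc_step ?rooted_root // eqxx.
  by left.
move=> w hw wr IH; have [->|wu] := eqVneq w u; first by left.
have [->|wv] := eqVneq w v; first by right.
by rewrite (desc_step hw wu) (desc_step hw wv) wr.
Qed.

Lemma parent_notin_desc v : v \in verts G -> v != rho -> p v \notin desc v.
Proof.
move=> hv vr; apply/negP => /desc_dep h; have := rooted_dep hv vr.
by case: h => [->|]; lia.
Qed.

Lemma desc_proper v : v \in verts G -> v != rho -> desc v \proper desc (p v).
Proof.
move=> hv vr; have hp := rooted_parent hv vr.
apply/properP; split; last by exists (p v); rewrite ?desc_refl ?parent_notin_desc.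
apply/subsetP => w /desc_trans; apply; apply: desc_parent => //; exact: desc_refl.
Qed.

(** Membership in [desc v] is the same for [x] and [p x] unless [x] is [v], so only the parent edge
    of [v] leaves [desc v]. *)
Lemma desc_cross v x y : v \in verts G -> v != rho -> adj G x y ->
  (x \in desc v) != (y \in desc v) -> [set x; y] = [set v; p v].
Proof.
move=> hv vr a.
wlog : x y a / [/\ x \in verts G, x != rho & y = p x].
  move=> W; case: (rooted_adjP x y a) => h; first exact: W.
  by rewrite eq_sym setUC; apply: W => //; rewrite adj_sym.
case=> hx xr -> {y a}; have [->//|xv] := eqVneq x v.
by rewrite (desc_step hx xv) xr eqxx.
Qed.

End Rooted.

(** * Steiner distance as a count of separating edges *)

Lemma connect_cross (V : finType) (e : rel V) (D : {set V}) x y :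
  connect e x y -> x \in D -> y \notin D -> exists a b, [/\ e a b, a \in D & b \notin D].
Proof.
case/connectP=> q; elim: q x => [|z q IH] x /=; first by move=> _ -> ->.
case/andP=> xz pq ey xD yD; have [zD|zD] := boolP (z \in D); first exact: (IH z).
by exists x, z.
Qed.

Section Steiner.

Variables (V : finType) (G : graph V) (rho : V) (p : V -> V) (dep : V -> nat).
Hypothesis rG : rooted G rho p dep.

Local Notation desc := (desc G rho p).
Local Notation n := #|verts G|.

Definition separates (S : {set V}) (v : V) : bool :=
  (S :&: desc v != set0) && (S :\: desc v != set0).

Lemma parent_edge_inj : {in verts G :\ rho &, injective (fun v => [set v; p v])}.
Proof.
move=> v w; rewrite !inE => /andP[vr hv] /andP[wr hw] /eq_set2[[]//|[e1 e2]].
by have := rooted_dep rG hv vr; have := rooted_dep rG hw wr; rewrite -e1 e2; lia.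
Qed.

(** If [v] separates [S], a connected [H] containing [S] must leave [desc v], and the parent edge of
    [v] is the only edge of [G] that does so. *)
Lemma steiner_dist_ge (S : {set V}) (H : graph V) :
  subgraph H G -> is_tree H -> S \subset verts H ->
  #|[set v in verts G :\ rho | separates S v]| <= #|edges H|.
Proof.
move=> /andP[_ EH] /andP[/andP[_ /forall_inP cH] _] SH.
rewrite -(@card_in_imset _ _ (fun v => [set v; p v])); last first.
  by move=> v w /setIdP[hv _] /setIdP[hw _]; apply: parent_edge_inj.
apply: subset_leq_card; apply/subsetP => _ /imsetP[v + ->].
rewrite !inE => /andP[/andP[vr hv] /andP[/set0Pn[x sx] /set0Pn[y sy]]].
have [/setIP[xS xD] /setDP[yS yD]] := (sx, sy).
have /forall_inP/(_ y (subsetP SH y yS)) := cH x (subsetP SH x xS).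
move=> /connect_cross/(_ xD yD) [a [b [ab aD bD]]].
by rewrite -(desc_cross rG hv vr (subsetP EH _ ab)) // aD (negbTE bD).
Qed.

(** The subtree consists of the paths from [S] up to its lowest common ancestor [r]. *)
Lemma steiner_dist_le (S : {set V}) :
  S \subset verts G -> S != set0 ->
  exists H : graph V, [/\ subgraph H G, is_tree H, S \subset verts H &
    #|edges H| <= #|[set v in verts G :\ rho | separates S v]| ].
Proof.
move=> SG /set0Pn[x0 x0S].
have Prho : (rho \in verts G) && (S \subset desc rho).
  by rewrite (rooted_root rG) (desc_root rG).
have [r /andP[hr Sr] rmax] :=
  @arg_maxnP V rho (fun a => (a \in verts G) && (S \subset desc a)) dep Prho.
pose W := [set v in desc r | S :&: desc v != set0].
have WG v : v \in W -> v \in verts G.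
  by rewrite inE => /andP[/(subsetP (desc_sub _ _ _ _))].
have Wstep v : v \in W -> v != r -> [/\ v != rho, p v \in W & separates S v].
  move=> vW; have hv := WG v vW; move: vW.
  rewrite inE => /andP[vr vS] nvr.
  move: (vr); rewrite (desc_step rG hv nvr) => /andP[vrho pr]; split=> //.
    rewrite inE pr; have /set0Pn[x] := vS; rewrite inE => /andP[xS xv].
    apply/set0Pn; exists x; rewrite inE xS.
    exact: (subsetP (proper_sub (desc_proper rG hv vrho))).
  (* If all of [S] lay below [v], then [v] would be a deeper choice than [r]. *)
  rewrite /separates vS; apply/negP => /eqP/eqP.
  rewrite setD_eq0 => Sv.
  have := rmax v; rewrite hv Sv => /(_ isT).
  case: (desc_dep rG vr) => [/eqP|]; first by rewrite (negbTE nvr).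
  by move=> lt le; have := leq_trans lt le; rewrite ltnn.
have simpW : simple_edges (W, [set [set v; p v] | v in W :\ r]).
  apply/forall_inP => _ /imsetP[v + ->]; rewrite in_setD1 => /andP[nvr vW].
  have [vrho pW _] := Wstep v vW nvr.
  have nvp : v != p v.
    by apply/eqP => e; have := rooted_dep rG (WG v vW) vrho; rewrite -e ltnn.
  rewrite cards2 nvp /=.
  by apply/subsetP => z; rewrite in_set2 => /orP[/eqP->|/eqP->].
pose H := Graph simpW.
have rW : r \in W.
  rewrite inE desc_refl //; apply/set0Pn; exists x0; rewrite inE x0S.
  exact: (subsetP Sr).
have rH : rooted H r p dep.
  split=> // v vW nvr; have [vrho pW _] := Wstep v vW nvr; split=> //.
  exact: (rooted_dep rG (WG v vW) vrho).
exists H; split.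
- apply/andP; split; first by apply/subsetP.
  apply/subsetP => _ /imsetP[v + ->]; rewrite in_setD1 => /andP[nvr vW].
  have [vrho pW _] := Wstep v vW nvr; exact: (rooted_edge rG (WG v vW) vrho).
- exact: (rooted_is_tree rH).
- apply/subsetP => x xS; rewrite inE (subsetP Sr) //.
  by apply/set0Pn; exists x; rewrite inE xS desc_refl // (subsetP SG).
apply: leq_trans (leq_imset_card _ _) _; apply: subset_leq_card.
apply/subsetP => v; rewrite in_setD1 => /andP[nvr vW].
by have [vrho pW sv] := Wstep v vW nvr; rewrite inE in_setD1 vrho (WG v vW).
Qed.

Lemma steiner_distE (S : {set V}) : S \subset verts G -> S != set0 ->
  steiner_dist G S = #|[set v in verts G :\ rho | separates S v]|.
Proof.
move=> SG S0; rewrite /steiner_dist.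
case: arg_minnP => [|H /and3P[HG tH SH] Hmin].
  by rewrite /subgraph !subxx SG (rooted_is_tree rG).
apply/eqP; rewrite eqn_leq steiner_dist_ge // andbT.
have [H' [s1 s2 s3]] := steiner_dist_le SG S0; apply: leq_trans.
by apply: Hmin; rewrite s1 s2 s3.
Qed.

(** An [r]-set not separated by [v] lies inside [desc v] or inside its complement. These sets are
    added on the left to avoid truncated subtraction. *)
Lemma steiner_wienerE r : 0 < r ->
  steiner_wiener r G +
    \sum_(v in verts G :\ rho) ('C(#|desc v|, r) + 'C(n - #|desc v|, r)) =
  \sum_(v in verts G :\ rho) 'C(n, r).
Proof.
move=> r0.
have -> : steiner_wiener r G = \sum_(v in verts G :\ rho)
    #|[set S : {set V} | [&& S \subset verts G, #|S| == r & separates S v]]|.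
  rewrite /steiner_wiener.
  rewrite (eq_bigr (fun S => \sum_(v in verts G :\ rho) separates S v)) => [|S].
    rewrite exchange_big; apply: eq_bigr => v _.
    rewrite -sum1dep_card; under [RHS]eq_bigl => S do rewrite andbA.
    by rewrite [RHS]big_mkcondr; apply: eq_bigr => S _; case: separates.
  case/andP=> SG /eqP Sr; rewrite steiner_distE //; last by rewrite -card_gt0 Sr.
  by rewrite -sum1dep_card big_mkcondr; apply: eq_bigr => v _; case: separates.
rewrite -big_split; apply: eq_bigr => v _ /=.
pose draws (A : {set V}) := [set S : {set V} | (S \subset A) && (#|S| == r)].
set D := desc v; have DG : D \subset verts G by exact: desc_sub.
rewrite -(cards_draws (verts G)) -(cards_draws D).
have -> : n - #|D| = #|verts G :\: D| by rewrite cardsD (setIidPr DG).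
rewrite -cards_draws -/(draws D) -/(draws (verts G :\: D)) -/(draws (verts G)).
(* No set is drawn from both sides: [r] is positive, which excludes the empty set. *)
have dis : [disjoint draws D & draws (verts G :\: D)].
  rewrite -setI_eq0; apply/eqP/setP => S; rewrite !inE.
  apply/negP => /andP[/andP[SD /eqP Sr] /andP[SD' _]].
  have /card_gt0P[x xS] : 0 < #|S| by rewrite Sr.
  by have /setDP[_] := subsetP SD' x xS; rewrite (subsetP SD).
rewrite -cardsUI; move: dis; rewrite -setI_eq0 => /eqP ->.
rewrite cards0 addn0 addnC.
have sub : draws D :|: draws (verts G :\: D) \subset draws (verts G).
  apply/subsetP => S; rewrite !inE subsetD.
  by case/orP=> /andP[]; [move=> /subset_trans-> //|move=> /andP[->]].
rewrite -(cardsID (draws D :|: draws (verts G :\: D)) (draws (verts G))).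
rewrite (setIidPr sub); congr (_ + _); apply: eq_card => S.
rewrite !inE subsetD /separates setD_eq0 -/D setI_eq0.
by case: (S \subset verts G); case: (#|S| == r); case: (S \subset D);
  case: [disjoint S & D].
Qed.

End Steiner.

(** * Numbers of labelled vertices and sums of largest degrees *)

Lemma leq_num_labelled D : {homo num_labelled D : i j / i <= j}.
Proof.
move=> i j /subnK <-; elim: (j - i) => // k IH; rewrite addSn /=.
exact: leq_trans IH (leq_addr _ _).
Qed.

(** The truncated subtraction in [num_labelled] rounds up at zero entries of [D], hence only an
    inequality. *)
Lemma num_labelled_ge D m : 0 < m ->
  \sum_(i < m) nth 0 D i + 2 <= num_labelled D m + m.
Proof.
case: m => // m _; elim: m => [|m IH]; first by rewrite big_ord_recr big_ord0 /=; lia.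
by rewrite big_ord_recr /=; move: IH => /=; lia.
Qed.

Lemma sum_ltn_ord m n : \sum_(k < n) (k < m) = minn m n.
Proof.
elim: n => [|n IH]; first by rewrite big_ord0 minn0.
by rewrite big_ord_recr IH /=; case: ltnP => ?; lia.
Qed.

Lemma sumn_subseq_sorted (D s : seq nat) :
  sorted geq D -> subseq s D -> sumn s <= sumn (take (size s) D).
Proof.
elim: D s => [|x D IH] [|y s] //= sD.
have sD' : sorted geq D by apply: path_sorted sD.
have xD : all (fun z => z <= x) D by apply: order_path_min sD => a b c /=; lia.
case: eqP => [->|_] sub; first by rewrite leq_add2l; apply: IH.
(* If [x] is skipped, putting [x] in place of the last entry taken from the tail does not lower the
   sum, as [x] bounds the tail. *)
apply: leq_trans (IH _ sD' sub) _ => /=.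
have := size_subseq sub; case: D {IH sD sD' sub} xD => //= z D /andP[zx aD] sz.
elim: {s}(size s) z D zx aD {sz} => [|k IH] z D zx aD /=; first by rewrite take0 /=; lia.
case: D aD => [|z' D] /=; first by lia.
by case/andP=> h1 h2; have := IH z' D h1 h2 => /=; lia.
Qed.

Lemma degree_seq_sorted (V : finType) (G : graph V) : sorted geq (degree_seq G).
Proof. by apply: sort_sorted => a b; rewrite /= leq_total. Qed.

Lemma size_degree_seq (V : finType) (G : graph V) : size (degree_seq G) = #|verts G|.
Proof. by rewrite size_sort size_map cardE. Qed.

Lemma sum_degree_le (V : finType) (G : graph V) (A : {set V}) :
  A \subset verts G ->
  \sum_(u in A) degree G u <= \sum_(i < #|A|) nth 0 (degree_seq G) i.
Proof.
(* Listing the vertices by decreasing degree turns the degrees over [A] into a subsequence of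
   [degree_seq G]. *)
move=> AG; pose t := sort (relpre (degree G) geq) (enum (verts G)).
have eD : degree_seq G = map (degree G) t by rewrite /degree_seq sort_map.
have pt : perm_eq t (enum (verts G)) by rewrite perm_sort.
have fA : perm_eq (filter (mem A) t) (enum A).
  apply: uniq_perm => [||x]; [|exact: enum_uniq|].
    by apply: filter_uniq; rewrite (perm_uniq pt) enum_uniq.
   rewrite mem_filter (perm_mem pt) !mem_enum inE.
  by case xA: (x \in A) => //=; rewrite (subsetP AG).
have -> : \sum_(u in A) degree G u = sumn (map (degree G) (filter (mem A) t)).
  by rewrite sumnE big_map (perm_big _ fA) big_enum.
have sub : subseq (map (degree G) (filter (mem A) t)) (degree_seq G).
  by rewrite eD map_subseq // filter_subseq.
apply: leq_trans (sumn_subseq_sorted (degree_seq_sorted G) sub) _.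
rewrite size_map (perm_size fA) -cardE sumnE.
have sz : #|A| <= size (degree_seq G) by rewrite size_degree_seq subset_leq_card.
rewrite (big_nth 0) size_takel // big_mkord; apply: leq_sum => i _.
by rewrite nth_take.
Qed.

(** * Layers of descendants around a parent-closed vertex set *)

Section Layers.

Variables (V : finType) (G : graph V) (rho : V) (p : V -> V) (dep : V -> nat).
Hypothesis rG : rooted G rho p dep.

Local Notation desc := (desc G rho p).
Local Notation n := #|verts G|.

Definition children (u : V) : {set V} := [set w in verts G :\ rho | p w == u].

Lemma degree_children u : u \in verts G -> degree G u = #|children u| + (u != rho).
Proof.
move=> hu; have [ur|ur] := eqVneq u rho.
  rewrite addn0; apply: eq_card => w; rewrite !inE; apply/(rooted_adjP rG)/idP.
    by case=> -[h1 h2 h3]; [rewrite ur eqxx in h2|rewrite h1 h2 h3 eqxx].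
  by case/andP=> /andP[h1 h2] /eqP h3; right.
have pN : p u \notin children u.
  rewrite !inE; apply/negP => /andP[/andP[h1 h2] /eqP h3].
  by have := rooted_dep rG hu ur; have := rooted_dep rG h2 h1; rewrite h3; lia.
have -> : degree G u = #|p u |: children u|.
  apply: eq_card => w; rewrite !inE; apply/(rooted_adjP rG)/idP.
    by case=> -[h1 h2 h3]; [rewrite h3 eqxx|rewrite h1 h2 h3 eqxx orbT].
  case/orP=> [/eqP ->|/andP[/andP[h1 h2] /eqP h3]]; [by left|by right].
by rewrite cardsU1 pN addnC.
Qed.

Lemma card_children_preimset (A : {set V}) : A \subset verts G ->
  #|rho |: [set w in verts G :\ rho | p w \in A]| = (\sum_(u in A) #|children u|).+1.
Proof.
move=> AG; rewrite cardsU1 !inE eqxx /= add1n; congr _.+1.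
rewrite -sum1dep_card (partition_big p (mem A)) => [|w /andP[]//].
apply: eq_bigr => u uA; rewrite -sum1dep_card; apply: eq_bigl => w.
have {}uA : u \in A by []; by case: eqP => [->|_]; rewrite ?uA ?andbT ?andbF.
Qed.

Lemma sum_children (A : {set V}) : A \subset verts G -> rho \in A ->
  \sum_(u in A) #|children u| + #|A| = (\sum_(u in A) degree G u).+1.
Proof.
move=> AG rA; rewrite [in RHS](eq_bigr (fun u => #|children u| + (u != rho))) => [|u uA]; last first.
  by rewrite degree_children // (subsetP AG).
rewrite big_split -addnS /=; congr (_ + _).
rewrite -sum1_card (bigD1 rho) //= add1n [in RHS](bigD1 rho) //= eqxx add0n.
by congr _.+1; apply: eq_bigr => u /andP[_ ->].
Qed.

(** Off the root, a vertex has one child fewer than its degree, and the degrees over [A] sum to at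
    most the [#|A|] largest ones, from which [num_labelled] counts in the same way. *)
Lemma sum_children_le (A : {set V}) : A \subset verts G -> rho \in A ->
  (\sum_(u in A) #|children u|).+1 <= num_labelled (degree_seq G) #|A|.
Proof.
move=> AG rA; have := sum_children AG rA; have := sum_degree_le AG.
have A0 : 0 < #|A| by apply/card_gt0P; exists rho.
by have := num_labelled_ge (degree_seq G) A0; lia.
Qed.

Variable U : {set V}.
Hypotheses (UG : U \subset verts G) (rU : rho \in U).
Hypothesis pU : forall v, v \in U -> v != rho -> p v \in U.

(* The depth of w in the forest obtained by deleting U, starting from 1 at its roots. *)
Definition forest_depth w := #|[set v in verts G :\: U | w \in desc v]|.

(** These are the sets $A_k$ grown from [U] by passing to the root and all children; [layerS] is the
    recursion. *)
Definition layer k := [set w in verts G | forest_depth w <= k].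

Lemma desc_notin w v : w \in U -> w \in desc v -> v \in U.
Proof.
move=> wU; have := subsetP UG w wU => wG; move: w wG wU.
apply: (rooted_vertex_ind rG).
  case: (eqVneq rho v) => [<- //|rv].
  by rewrite (desc_step rG (rooted_root rG) rv) eqxx.
move=> w wG wr IH wU; have [<-//|wv] := eqVneq w v.
by rewrite (desc_step rG wG wv) wr; apply: IH; apply: pU.
Qed.

Lemma forest_depth0 w : w \in U -> forest_depth w = 0.
Proof.
move=> wU; apply/eqP; rewrite cards_eq0; apply/eqP/setP => v; rewrite in_set0.
by apply/negP => /setIdP[/setDP[_ vU] wv]; rewrite (desc_notin wU wv) in vU.
Qed.

Lemma forest_depthS w : w \in verts G -> w \notin U ->
  forest_depth w = (forest_depth (p w)).+1.
Proof.
move=> wG wU; have wr : w != rho by apply: contraNneq wU => ->.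
have := parent_notin_desc rG wG wr; rewrite /forest_depth => np.
have wS : w \in [set v in verts G :\: U | w \in desc v].
  by apply/setIdP; rewrite in_setD wU desc_refl.
rewrite (cardsD1 w) wS add1n; congr _.+1; apply: eq_card => v; rewrite in_setD1.
have [->|vw] /= := eqVneq v w.
  by apply/esym/negbTE/negP => /setIdP[_]; apply/negP.
have e : (w \in desc v) = (p w \in desc v).
  by rewrite eq_sym in vw; rewrite (desc_step rG wG vw) wr.
by apply/setIdP/setIdP; rewrite e.
Qed.

Lemma layer_sub k : layer k \subset verts G.
Proof. by apply/subsetP => w; rewrite inE => /andP[]. Qed.

Lemma layer_root k : rho \in layer k.
Proof. by rewrite inE (rooted_root rG) forest_depth0. Qed.

Lemma layer0 : layer 0 = U.
Proof.
apply/setP => w; rewrite inE leqn0; apply/andP/idP => [[wG]|wU].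
  by apply: contraLR => wU; rewrite forest_depthS.
by rewrite (subsetP UG) ?forest_depth0.
Qed.

Lemma layerS k : layer k.+1 = rho |: [set w in verts G :\ rho | p w \in layer k].
Proof.
apply/setP => w; rewrite !in_setU1 [w \in [set _ in _ | _]]inE in_setD1.
have [->|wr] /= := eqVneq w rho; first exact: layer_root.
rewrite !inE; case wG: (w \in verts G) => //=; rewrite (rooted_parent rG) //=.
have [wU|wU] := boolP (w \in U); last by rewrite forest_depthS.
by rewrite !forest_depth0 // pU.
Qed.

Lemma card_layerS k : #|layer k.+1| <= num_labelled (degree_seq G) #|layer k|.
Proof.
rewrite layerS card_children_preimset ?layer_sub //.
by rewrite sum_children_le ?layer_sub ?layer_root.
Qed.

Lemma card_layer k : #|layer k| <= iter k (num_labelled (degree_seq G)) #|U|.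
Proof.
elim: k => [|k IH]; first by rewrite layer0.
exact: leq_trans (card_layerS k) (leq_num_labelled _ IH).
Qed.

(** Counting pairs of a vertex and an ancestor outside [U] turns the left side into the sum of all
    forest depths. A depth, being at most [n], is the number of [k < n] below it. *)
Lemma sum_desc_layers :
  \sum_(v in verts G :\: U) #|desc v| = \sum_(k < n) (n - #|layer k|).
Proof.
have -> : \sum_(v in verts G :\: U) #|desc v| = \sum_(w in verts G) forest_depth w.
  rewrite (eq_bigr (fun v => \sum_(w in verts G) (w \in desc v))); last first.
    move=> v _; rewrite -sum1_card big_mkcond [RHS]big_mkcond; apply: eq_bigr => w _.
    case wG: (w \in verts G); first by case: ifP.
    by rewrite ifF //; apply: contraFF wG; apply: (subsetP (desc_sub _ _ _ _)).
  rewrite exchange_big; apply: eq_bigr => w _.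
  rewrite /forest_depth -sum1dep_card [RHS]big_mkcondr; apply: eq_bigr => v _.
  by case: (_ \in desc v).
rewrite (eq_bigr (fun w => \sum_(k < n) (k < forest_depth w))); last first.
  move=> w _; have : forest_depth w <= n.
    by apply: subset_leq_card; apply/subsetP => v; rewrite !inE => /andP[/andP[]].
  by move=> le; rewrite sum_ltn_ord (minn_idPl le).
rewrite exchange_big; apply: eq_bigr => k _ /=.
have -> : n - #|layer k| = #|verts G :\: layer k|.
  by rewrite cardsD (setIidPr (layer_sub k)).
rewrite -[RHS]sum1_card [LHS]big_mkcond [RHS]big_mkcond; apply: eq_bigr => w _.
by rewrite !inE negb_and -ltnNge; case: (w \in verts G) => //=; case: ltnP.
Qed.

End Layers.

(** * Rooting an arbitrary tree *)

Lemma adj_verts (V : finType) (G : graph V) x y :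
  adj G x y -> [/\ x != y, x \in verts G & y \in verts G].
Proof.
move=> a; have /forall_inP/(_ _ a) := graph_valP G.
rewrite cards2 => /andP[+ sub]; have [//|xy] := eqVneq x y; move=> _.
by split=> //; apply: (subsetP sub); rewrite !inE eqxx ?orbT.
Qed.

(** A repetition-free path avoiding the edge would close up with it to a cycle on at least three
    vertices. *)
Lemma acyclic_bridge (V : finType) (G : graph V) x y : acyclic G -> adj G x y ->
  ~~ connect (fun a b => adj G a b && ([set a; b] != [set x; y])) x y.
Proof.
move=> /acyclicP aG xy; apply/negP => /connectP[q0 /shortenP[q pq uq _]] ey.
have /aG : ucycle (adj G) (x :: q).
  rewrite /ucycle uq andbT /= rcons_path -ey adj_sym xy andbT.
  by apply: sub_path pq => a b /andP[].
case: q pq uq ey => [|z [|z' q]] //=.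
  by move=> _ _ e; have [] := adj_verts xy; rewrite e eqxx.
by move=> /andP[/andP[_ ne] _] _ e; rewrite e eqxx in ne.
Qed.

Section TreeRoot.

Variables (V : finType) (G : graph V) (rho : V).

Definition reaches (v : V) (k : nat) : bool :=
  [exists c : k.-tuple V, path (adj G) v c && (last v c == rho)].

(** Lengths below [#|V|] suffice, since a connecting path can be taken without repetitions; [find]
    gives [#|V|] when none works. *)
Definition root_dist (v : V) : nat := find (reaches v) (iota 0 #|V|).

Definition root_parent (v : V) : V :=
  odflt v [pick z | adj G v z && (root_dist z < root_dist v)].

Lemma root_dist_le v k : reaches v k -> k < #|V| -> root_dist v <= k.
Proof.
move=> rk kV; rewrite leqNgt; apply/negP => /(before_find 0).
by rewrite nth_iota // add0n rk.
Qed.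

Lemma root_parentP v : connected G -> rho \in verts G -> v \in verts G -> v != rho ->
  adj G v (root_parent v) /\ root_dist (root_parent v) < root_dist v.
Proof.
move=> /andP[_ /forall_inP cG] hr hv vr.
suff [z h] : exists z, adj G v z && (root_dist z < root_dist v).
  by rewrite /root_parent; case: pickP => [z' /andP[]//|/(_ z)]; rewrite h.
have hs : has (reaches v) (iota 0 #|V|).
  have /connectP[q0 /shortenP[q pq uq _] e] := forall_inP (cG v hv) rho hr.
  apply/hasP; exists (size q).
    by rewrite mem_iota /= add0n; have := max_card (mem (v :: q)); rewrite (card_uniqP uq).
  by apply/existsP; exists (in_tuple q); rewrite /= pq -e eqxx.
have dV : root_dist v < #|V| by move: hs; rewrite has_find size_iota.
have := nth_find 0 hs; rewrite nth_iota // add0n -/(root_dist v).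
case/existsP=> -[[|z q] sz]; first by rewrite /= (negbTE vr).
have /= /esym sq := eqP sz; case/andP=> /andP[vz pq] lq; exists z; rewrite vz /= sq ltnS; apply: root_dist_le.
  by apply/existsP; exists (in_tuple q); rewrite /= pq.
by rewrite sq in dV; apply: ltnW.
Qed.

Lemma tree_rooted : is_tree G -> rho \in verts G -> rooted G rho root_parent root_dist.
Proof.
move=> /andP[cG aG] hr; have par := fun v => @root_parentP v cG hr.
split=> //; first by move=> v hv vr; have [/adj_verts[]] := par v hv vr.
apply/eqP; rewrite eqEsubset andbC; apply/andP; split.
  by apply/subsetP => _ /imsetP[v /setD1P[vr hv] ->]; have [] := par v hv vr.
apply/subsetP => e he; apply/imsetP.
have [v hv|ne] := pickP (fun v => (v \in verts G :\ rho) && (e == [set v; root_parent v])).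
  by case/andP: hv => hv /eqP ->; exists v.
have /forall_inP/(_ _ he)/andP[/cards2P[x [y [xy ee]]] _] := graph_valP G.
(* If [e] were not a parent edge, climbing to the root would avoid it and join its ends without it,
   although an edge of an acyclic graph is a bridge. *)
have axy : adj G x y by rewrite /adj -ee.
set r := (fun a b => adj G a b && ([set a; b] != e)).
have symr : symmetric r by move=> a b; rewrite /r adj_sym setUC.
have cr : forall v, v \in verts G -> connect r v rho.
  move=> v; elim: {v}_.+1 {-2}v (ltnSn (root_dist v)) => // m IH v hm hv.
  have [->//|vr] := eqVneq v rho; have [pa pd] := par v hv vr.
  have [_ _ pv] := adj_verts pa.
  apply: (connect_trans (connect1 _) (IH _ _ pv)); last by lia.
  by rewrite /r pa; have := ne v; rewrite !inE vr hv /= eq_sym => ->.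
have [_ hx hy] := adj_verts axy.
have := acyclic_bridge aG axy; rewrite -ee -/r (connect_trans (cr x hx)) //.
by rewrite (sym_connect_sym symr); exact: cr.
Qed.

End TreeRoot.

(** * Existence of a centroid *)

Lemma tree_centroid (V : finType) (G : graph V) : is_tree G ->
  exists rho p dep, rooted G rho p dep /\
    forall v, v \in verts G -> v != rho -> 2 * #|desc G rho p v| <= #|verts G|.
Proof.
move=> tG; have /andP[/andP[/set0Pn[r0 hr0] _] _] := tG.
set p0 := root_parent G r0; set d0 := root_dist G r0.
have R0 : rooted G r0 p0 d0 := tree_rooted tG hr0.
have P0 : (r0 \in verts G) && (#|verts G| < 2 * #|desc G r0 p0 r0|).
  rewrite hr0 (desc_root R0); have : 0 < #|verts G| by apply/card_gt0P; exists r0.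
  by lia.
(* The deepest vertex with more than n/2 descendants is a centroid. *)
have [c /andP[hc cbig] cmax] := @arg_maxnP V r0
  (fun v => (v \in verts G) && (#|verts G| < 2 * #|desc G r0 p0 v|)) d0 P0.
set p := root_parent G c; set d := root_dist G c.
have R : rooted G c p d := tree_rooted tG hc.
exists c, p, d; split=> // v hv vc.
have [w [hw wr ew]] := rooted_edgeP R0 _ (rooted_edge R hv vc).
set D := desc G r0 p0 w; have DG : D \subset verts G := desc_sub _ _ _ _.
(* Removing the edge between v and its parent in the tree rooted at c splits the
   vertices into D and its complement; X is the part that does not contain c. *)
pose X := if c \in D then verts G :\: D else D.
have cX : c \notin X by rewrite /X; case: ifP => [cD|->//]; rewrite inE cD.
have XD u : u \in verts G -> (u \in X) = (u \in D) (+) (c \in D).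
  by move=> hu; rewrite /X; case: (c \in D); rewrite ?inE ?hu /= ?addbT ?addbF ?andbT.
have cross u : u \in verts G -> u != c -> u != v -> (u \in X) = (p u \in X).
  move=> hu uc uv; have hpu := rooted_parent R hu uc.
  rewrite !XD //; congr (_ (+) _); apply/eqP; apply: contraNT uv => ne.
  have := desc_cross R0 hw wr (rooted_edge R hu uc) ne; rewrite -ew => ee.
  by apply/eqP; apply: (parent_edge_inj R) ee; rewrite !inE ?uc ?vc.
have hpv := rooted_parent R hv vc.
have vX : (v \in X) != (p v \in X).
  have wD : w \in D by exact: desc_refl.
  have pwD : p0 w \notin D by exact: (parent_notin_desc R0).
  rewrite !XD //; case/eq_set2: ew => -[-> ->]; rewrite wD (negbTE pwD);
  by case: (c \in D).
have side u : u \in verts G ->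
    if u \in desc G c p v then (u \in X) = (v \in X) else u \notin X.
  move: u; apply: (rooted_vertex_ind R).
    by rewrite (desc_step R hc) 1?eq_sym // eqxx.
  move=> u hu uc; have [->|uv] := eqVneq u v; first by rewrite desc_refl.
  by rewrite (desc_step R hu uv) uc /= -cross.
have vinX : v \in X.
  have := side _ hpv; rewrite (negbTE (parent_notin_desc R hv vc)) => /negbTE h.
  by move: vX; rewrite h; case: (v \in X).
have sub : #|desc G c p v| <= #|X|.
  apply: subset_leq_card; apply/subsetP => u hu.
  by have := side u (subsetP (desc_sub _ _ _ _) u hu); rewrite hu vinX.
apply: leq_trans (leq_mul (leqnn 2) sub) _; rewrite /X; case: ifP => cD.
  (* Here [D] contains all descendants of [c], more than half of the vertices, so its complement is
     small. *)
  rewrite cardsD (setIidPr DG).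
  have : #|desc G r0 p0 c| <= #|D|.
    by apply: subset_leq_card; apply/subsetP => u /desc_trans; apply.
  by move: cbig; clear; lia.
(* Here a large [D] would meet the large set below [c], so [w] would lie strictly below [c], against
   the choice of [c] as deepest. *)
rewrite leqNgt; apply/negP => big.
have : D :&: desc G r0 p0 c != set0.
  apply/eqP => e0; have := cardsUI D (desc G r0 p0 c); rewrite e0 cards0.
  have : #|D :|: desc G r0 p0 c| <= #|verts G|.
    by apply: subset_leq_card; rewrite subUset DG desc_sub.
  by move: cbig big; clear; lia.
case/set0Pn=> x /setIP[xD xc]; case: (desc_laminar R0 xD xc); last by rewrite cD.
case/(desc_dep R0) => [ewc|lt]; first by rewrite /D ewc desc_refl in cD.
have := cmax w; rewrite hw big => /(_ isT) le.
by have := leq_trans lt le; rewrite ltnn.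
Qed.

(** * Prefixes of the list by subtree size; arithmetic of tree degree sequences *)

Lemma card_lt_ord n b : #|[set w : 'I_n | w < b]| = minn b n.
Proof.
rewrite -sum_ltn_ord -sum1dep_card big_mkcond; apply: eq_bigr => w _.
by case: ltnP.
Qed.

Section Prefix.

Variables (V : finType) (G : graph V) (rho : V) (p : V -> V) (dep : V -> nat).
Hypothesis rG : rooted G rho p dep.

Local Notation desc := (desc G rho p).
Local Notation n := #|verts G|.

(* A parent has more descendants than its child, so that the prefixes of this list
   are closed under taking parents. *)
Definition by_size : seq V := sort (relpre (fun v => #|desc v|) geq) (enum (verts G)).

Definition prefix_set i : {set V} := [set v in take i by_size].

Lemma perm_by_size : perm_eq by_size (enum (verts G)).
Proof. by rewrite perm_sort. Qed.

Lemma mem_by_size v : (v \in by_size) = (v \in verts G).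
Proof. by rewrite (perm_mem perm_by_size) mem_enum. Qed.

Lemma size_by_size : size by_size = n.
Proof. by rewrite (perm_size perm_by_size) cardE. Qed.

Lemma uniq_by_size : uniq by_size.
Proof. by rewrite (perm_uniq perm_by_size) enum_uniq. Qed.

Lemma by_size_sorted : sorted (relpre (fun v => #|desc v|) geq) by_size.
Proof. by apply: sort_sorted => a b; rewrite /= leq_total. Qed.

Lemma index_parent v : v \in verts G -> v != rho ->
  index (p v) by_size < index v by_size.
Proof.
move=> hv vr; have hp := rooted_parent rG hv vr.
have lt := proper_card (desc_proper rG hv vr).
have tr : transitive (relpre (fun v => #|desc v|) geq).
  by move=> y x z /= xy yz; apply: leq_trans yz xy.
case: ltngtP => // [ltv|e].
  have := sorted_ltn_index tr by_size_sorted v (p v).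
  by rewrite !mem_by_size => /(_ hv hp ltv) /= le; have := leq_trans lt le; rewrite ltnn.
have := congr1 (nth rho by_size) e; rewrite !nth_index ?mem_by_size // => ev.
by have := rooted_dep rG hv vr; rewrite ev ltnn.
Qed.

Lemma mem_prefix i v : (v \in prefix_set i) = (v \in verts G) && (index v by_size < i).
Proof.
rewrite inE; have [hv|hv] := boolP (v \in verts G); first by rewrite in_take ?mem_by_size.
by apply/negbTE; apply: contra hv => /mem_take; rewrite mem_by_size.
Qed.

Lemma prefix_sub i : prefix_set i \subset verts G.
Proof. by apply/subsetP => v; rewrite mem_prefix => /andP[]. Qed.

Lemma card_prefix i : i <= n -> #|prefix_set i| = i.
Proof.
move=> le; rewrite /prefix_set cardsE (card_uniqP _) ?take_uniq ?uniq_by_size //.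
by rewrite size_takel ?size_by_size.
Qed.

Lemma prefix_parent i v : v \in prefix_set i.+1 -> v != rho -> p v \in prefix_set i.
Proof.
rewrite !mem_prefix => /andP[hv lt] vr; rewrite (rooted_parent rG) //=.
by have := index_parent hv vr; lia.
Qed.

Lemma prefix_closed i v : v \in prefix_set i -> v != rho -> p v \in prefix_set i.
Proof.
rewrite !mem_prefix => /andP[hv lt] vr; rewrite (rooted_parent rG) //=.
by have := index_parent hv vr; lia.
Qed.

Lemma index_root : index rho by_size = 0.
Proof.
have n0 : 0 < n by apply/card_gt0P; exists rho; exact: (rooted_root rG).
have hx : nth rho by_size 0 \in verts G by rewrite -mem_by_size mem_nth ?size_by_size.
have [e|ne] := eqVneq (nth rho by_size 0) rho.
  by rewrite -{1}e index_uniq ?size_by_size ?uniq_by_size.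
by have := index_parent hx ne; rewrite index_uniq ?size_by_size ?uniq_by_size.
Qed.

Lemma prefix_root i : 0 < i -> rho \in prefix_set i.
Proof. by rewrite mem_prefix index_root (rooted_root rG). Qed.

Lemma prefix1 : prefix_set 1 = [set rho].
Proof.
apply/eqP; rewrite eq_sym eqEcard sub1set prefix_root // cards1.
by rewrite card_prefix //; apply/card_gt0P; exists rho; exact: (rooted_root rG).
Qed.

(** The root and the children of the first [i] vertices include the first [i.+1] vertices. For the
    greedy tree this means that vertex [i] is labelled before it is processed. *)
Lemma ltn_num_labelled i : 0 < i < n -> i < num_labelled (degree_seq G) i.
Proof.
case/andP=> i0 iN; rewrite -{1}(card_prefix iN).
have sub := prefix_sub i.
have := sum_children_le rG sub (prefix_root i0); rewrite card_prefix; last exact: ltnW.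
apply: leq_trans; rewrite -(card_children_preimset rho p sub).
apply: subset_leq_card; apply/subsetP => v vP; rewrite in_setU1.
have [//|vr] /= := eqVneq v rho.
by rewrite inE in_setD1 vr (subsetP (prefix_sub _) _ vP) prefix_parent.
Qed.

Lemma sum_degree : (\sum_(u in verts G) degree G u).+2 = 2 * n.
Proof.
have s : verts G \subset verts G by [].
have := sum_children rG s (rooted_root rG); have := card_children_preimset rho p s.
have -> : rho |: [set w in verts G :\ rho | p w \in verts G] = verts G.
  apply/setP => w; rewrite in_setU1 inE in_setD1.
  have [->|wr] /= := eqVneq w rho; first by rewrite (rooted_root rG).
  by have [hw|] := boolP (w \in verts G); rewrite // (rooted_parent rG).
by lia.
Qed.

Lemma degree_gt0 u : 1 < n -> u \in verts G -> 0 < degree G u.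
Proof.
move=> n1 hu; have [v hv vu] : exists2 v, v \in verts G & v != u.
  have /card_gt0P[v] : 0 < #|verts G :\ u| by have := cardsD1 u (verts G); rewrite hu; lia.
  by rewrite in_setD1 => /andP[vu hv]; exists v.
have /andP[_ /forall_inP/(_ u hu)/forall_inP/(_ v hv)] := rooted_connected rG.
case/connectP=> [[|z q]] /=; first by move=> _ e; rewrite e eqxx in vu.
by case/andP=> uz _ _; apply/card_gt0P; exists z; rewrite inE.
Qed.

Lemma degree_seq_gt0 i : 0 < i < n -> 0 < nth 0 (degree_seq G) i.
Proof.
move=> /andP[i0 iN]; have : nth 0 (degree_seq G) i \in degree_seq G.
  by rewrite mem_nth // size_degree_seq.
rewrite {2}/degree_seq mem_sort => /mapP[u]; rewrite mem_enum => hu ->.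
by apply: degree_gt0 => //; lia.
Qed.

(** Entries after the first are positive, so the truncated subtraction in [num_labelled] is
    exact. *)
Lemma num_labelledE i : 0 < i <= n ->
  num_labelled (degree_seq G) i + i = \sum_(j < i) nth 0 (degree_seq G) j + 2.
Proof.
case: i => // i; rewrite /=; elim: i => [|i IH] iN.
  by rewrite big_ord_recr big_ord0 /=; lia.
rewrite big_ord_recr /=; have := IH (ltnW iN); rewrite /=.
by have := @degree_seq_gt0 i.+1 iN; lia.
Qed.

(** The degrees of a tree sum to $2n-2$, so the greedy procedure labels [n] vertices in all. *)
Lemma num_labelled_size : num_labelled (degree_seq G) n = n.
Proof.
have n0 : 0 < n <= n by rewrite leqnn andbT; apply/card_gt0P; exists rho; exact: (rooted_root rG).
have := num_labelledE n0.
suff -> : \sum_(j < n) nth 0 (degree_seq G) j = \sum_(u in verts G) degree G u.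
  by have := sum_degree; lia.
rewrite -(big_mkord xpredT (nth 0 (degree_seq G))) -size_degree_seq.
rewrite -(big_nth 0 xpredT id) (perm_big [seq degree G x | x <- enum (verts G)]).
  by rewrite big_map big_enum.
by rewrite /degree_seq perm_sort.
Qed.

End Prefix.

(** * The greedy tree *)

Section Greedy.

Variable D : seq nat.
Local Notation n := (size D).
Local Notation N := (num_labelled D).
Hypotheses (n0 : 0 < n) (DN : forall i, 0 < i < n -> i < N i) (Dn : N n = n).

Definition greedy_root : 'I_n := Ordinal n0.

Definition greedy_parent (j : 'I_n) : 'I_n := odflt j [pick i : 'I_n | greedy_child D i j].

Local Notation rho := greedy_root.
Local Notation p := greedy_parent.

Lemma greedy_child_lt (i j : 'I_n) : greedy_child D i j -> i < j.
Proof.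
case/andP=> le _; apply: leq_trans le; case: (posnP i) => [->//|i0].
by apply: DN; rewrite i0 /=.
Qed.

Lemma greedy_child_uniq (i i' j : nat) : greedy_child D i j -> greedy_child D i' j -> i = i'.
Proof.
move=> /andP[a b] /andP[a' b']; case: (ltngtP i i') => // h.
  by have := leq_num_labelled D h; lia.
by have := leq_num_labelled D h; lia.
Qed.

Lemma greedy_parentP (j : 'I_n) : j != rho -> greedy_child D (p j) j.
Proof.
move=> jr; rewrite /greedy_parent; case: pickP => //= none.
have j0 : 0 < j by rewrite lt0n; apply: contra jr => /eqP e; apply/eqP/val_inj.
have ex : exists m, j < N m by exists n; rewrite Dn.
(* The parent is the predecessor of the least [m] with [j < N m]; that [m] is not 0, because [N 0]
   is 1 and [j] is positive. *)
have := ex_minnP ex; case=> [[|m]] /= jm mmin; first by move: jm; lia.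
have mn : m < n by apply: mmin; rewrite Dn.
have := none (Ordinal mn); rewrite /greedy_child /= jm andbT leqNgt.
by move=> /negbFE /mmin; rewrite ltnn.
Qed.

Lemma greedy_child_neq_root (i j : 'I_n) : greedy_child D i j -> j != rho.
Proof.
by move=> /greedy_child_lt h; apply/eqP => e; rewrite e in h.
Qed.

Lemma greedy_childE (i j : 'I_n) : greedy_child D i j = (j != rho) && (p j == i).
Proof.
apply/idP/andP => [c|[jr /eqP <-]]; last exact: greedy_parentP.
have jr := greedy_child_neq_root c; split=> //; apply/eqP/val_inj.
exact: (greedy_child_uniq (greedy_parentP jr) c).
Qed.

Lemma verts_greedy : verts (greedy_tree D) = [set: 'I_n].
Proof. by []. Qed.

Lemma greedy_rooted : rooted (greedy_tree D) rho p (fun j => j : nat).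
Proof.
split=> [|v _ vr|]; first by rewrite verts_greedy inE.
  by rewrite verts_greedy inE; split=> //; apply/greedy_child_lt/greedy_parentP.
apply/setP => e; apply/imsetP/imsetP => [[[i j]]|[j]].
  rewrite inE /= greedy_childE => /and3P[_ jr /eqP <-] ->.
  by exists j; rewrite ?in_setD1 ?jr ?verts_greedy ?inE // setUC.
rewrite in_setD1 => /andP[jr _] ->; exists (p j, j); last by rewrite setUC.
have c := greedy_parentP jr; rewrite inE /= c andbT.
by apply/eqP => e'; have := greedy_child_lt c; rewrite e' ltnn.
Qed.

(** The equality case of [card_layer]: the children of consecutive vertices get consecutive labels,
    so an initial segment grows into an initial segment. *)
Lemma greedy_layer j k : 0 < j ->
  layer (greedy_tree D) rho p [set w : 'I_n | w < j] k =
  [set w : 'I_n | w < iter k N j].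
Proof.
move=> j0; have rG := greedy_rooted.
have UG : [set w : 'I_n | w < j] \subset verts (greedy_tree D) by rewrite verts_greedy subsetT.
have rU : rho \in [set w : 'I_n | w < j] by rewrite inE.
have pU v : v \in [set w : 'I_n | w < j] -> v != rho -> p v \in [set w : 'I_n | w < j].
  by rewrite !inE => vj /greedy_parentP/greedy_child_lt; lia.
have it0 m : 0 < iter m N j.
  by case: m => //= m; apply: leq_trans (leq_num_labelled D (leq0n _)).
elim: k => [|k IH]; first exact: (layer0 rG).
rewrite (layerS rG) // IH; apply/setP => w; rewrite in_setU1 inE in_setD1 !inE andbT.
have [->|wr] := eqVneq w rho; first by rewrite (it0 k.+1).
rewrite iterS /=; have /andP[c1 c2] := greedy_parentP wr.
case: ltnP => h; first by have := leq_num_labelled D h; lia.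
by have := leq_num_labelled D h; lia.
Qed.

Lemma greedy_sum_desc j : 0 < j ->
  \sum_(v in [set: 'I_n] :\: [set w : 'I_n | w < j]) #|desc (greedy_tree D) rho p v| =
  \sum_(k < n) (n - iter k N j).
Proof.
move=> j0; rewrite -[in LHS]verts_greedy sum_desc_layers verts_greedy cardsT card_ord.
by apply: eq_bigr => k _; rewrite greedy_layer // card_lt_ord; lia.
Qed.

Hypothesis Dpos : forall i, 0 < i < n -> 0 < nth 0 D i.

(** Vertex [i] has [N i.+1 - N i] children; off the root, [Dpos] makes this one less than its entry,
    without truncation. *)
Lemma greedy_degree (i : 'I_n) : degree (greedy_tree D) i = nth 0 D i.
Proof.
rewrite (degree_children greedy_rooted) ?verts_greedy ?inE //.
have iN : N i.+1 <= n by rewrite -[X in _ <= X]Dn; apply: leq_num_labelled.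
have iN' : N i <= N i.+1 by apply: leq_num_labelled.
have -> : children (greedy_tree D) rho p i =
    [set w : 'I_n | w < N i.+1] :\: [set w : 'I_n | w < N i].
  apply/setP => w; rewrite inE in_setD1 verts_greedy in_setT andbT -greedy_childE.
  by rewrite !inE -leqNgt.
rewrite cardsD (setIidPr _); last by apply/subsetP => w; rewrite !inE => /leq_trans; apply.
rewrite !card_lt_ord !(minn_idPl _) //; last exact: leq_trans iN.
rewrite /= addKn; have [i0|i0] := posnP i.
  have -> : i = rho by apply: val_inj.
  by rewrite eqxx /= subn0 addn0.
have -> : i != rho by apply/eqP => e; rewrite e in i0.
by have := Dpos (i := i); rewrite i0 ltn_ord => /(_ isT); lia.
Qed.

Hypothesis Dsorted : sorted geq D.

Lemma greedy_degree_seq : degree_seq (greedy_tree D) = D.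
Proof.
rewrite /degree_seq verts_greedy enum_setT.
have -> : [seq degree (greedy_tree D) x | x <- Finite.enum 'I_n] = D.
  rewrite (eq_map greedy_degree) -enumT.
  have -> : [seq nth 0 D (i : 'I_n) | i <- enum 'I_n] = map (nth 0 D) (map val (enum 'I_n)).
    by rewrite -map_comp.
  by rewrite val_enum_ord; apply: mkseq_nth.
by apply: sorted_sort => // a b c /= h1 h2; apply: leq_trans h2 h1.
Qed.

End Greedy.

(** * Convexity of binomial coefficients and summation by parts *)

Lemma bin_slope_le x d r : 'C(x, r.+1) + d * 'C(x, r) <= 'C(x + d, r.+1).
Proof.
elim: d => [|d IH]; first by rewrite addn0; lia.
rewrite addnS binS; have := leq_bin2l r (leq_addr d x).
by move: IH; rewrite mulSn; lia.
Qed.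

(** By Pascal's rule the unit steps from [x] to [x + d] add ['C(y, r)] for [y] from [x] to
    [(x + d).-1], the last being the largest. *)
Lemma bin_slope_ge x d r : 'C(x + d, r.+1) <= 'C(x, r.+1) + d * 'C((x + d).-1, r).
Proof.
elim: d => [|d IH]; first by rewrite addn0; lia.
have le : d * 'C((x + d).-1, r) <= d * 'C(x + d, r).
  by rewrite leq_mul2l leq_bin2l ?leq_pred ?orbT.
by move: IH; rewrite addnS binS mulSn /=; lia.
Qed.

(* c is the slope of a supporting line at a of the convex function x |-> 'C(x, r.+1). *)
Lemma bin_tangent a b c r : 'C(a.-1, r) <= c <= 'C(a, r) ->
  'C(a, r.+1) + b * c <= 'C(b, r.+1) + a * c.
Proof.
case/andP=> c1 c2; have [ab|/ltnW ba] := leqP a b.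
  have := bin_slope_le a (b - a) r; rewrite subnKC //.
  have : (b - a) * c <= (b - a) * 'C(a, r) by rewrite leq_mul2l c2 orbT.
  have : a * c <= b * c by rewrite leq_mul2r ab orbT.
  by rewrite mulnBl; lia.
have := bin_slope_ge b (a - b) r; rewrite subnKC //.
have : (a - b) * 'C(a.-1, r) <= (a - b) * c by rewrite leq_mul2l c1 orbT.
have : b * c <= a * c by rewrite leq_mul2r ba orbT.
by rewrite mulnBl; lia.
Qed.

(** For positive [r], this counts the [r]-sets left unseparated by an edge that cuts off [x] of [n]
    vertices. *)
Definition bin_cut n r x := 'C(x, r) + 'C(n - x, r).

(** Minus the slope of a supporting line of [bin_cut n r.+1] at [x]; the sign makes it a natural
    number for [x] up to half of [n]. *)
Definition cut_slope n r x := 'C(n - x, r) - 'C(x.-1, r).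

Lemma bin_cut_tangent n r a b : 0 < a -> 2 * a <= n -> b <= n ->
  bin_cut n r.+1 a + cut_slope n r a * a <= bin_cut n r.+1 b + cut_slope n r a * b.
Proof.
move=> a0 an bn; rewrite /bin_cut /cut_slope.
have c1 : 'C(a.-1, r) <= 'C(a, r) by rewrite leq_bin2l ?leq_pred.
have c2 : 'C((n - a).-1, r) <= 'C(n - a, r) by rewrite leq_bin2l ?leq_pred.
have le : 'C(a.-1, r) <= 'C(n - a, r) by rewrite leq_bin2l //; lia.
(* Two supporting lines are added, with the left slope at [a] and the right slope at [n - a]. *)
have := @bin_tangent a b 'C(a.-1, r) r; rewrite leqnn c1 => /(_ isT).
have := @bin_tangent (n - a) (n - b) 'C(n - a, r) r; rewrite leqnn c2 => /(_ isT).
by nia.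
Qed.

Lemma cut_slope_decr n r a a' : a' <= a -> cut_slope n r a <= cut_slope n r a'.
Proof.
move=> le; apply: leq_sub; apply: leq_bin2l; lia.
Qed.

(** The two sides differ by [w 1] times the difference of the full sums, plus the increments of [w]
    times the differences of later suffix sums, all non-negative. *)
Lemma weighted_suffix_sums (w a b : nat -> nat) n :
  (forall i, 0 < i -> i.+1 < n -> w i <= w i.+1) ->
  (forall j, 0 < j <= n -> \sum_(j <= i < n) b i <= \sum_(j <= i < n) a i) ->
  \sum_(1 <= i < n) w i * b i <= \sum_(1 <= i < n) w i * a i.
Proof.
move=> wmono sab.
case: n => [|n] in wmono sab *; first by rewrite !big_geq.
(* Abel summation, with the differences written as sums on both sides. *)
have abel j : 0 < j <= n ->
    \sum_(j <= i < n.+1) w i * b i + w j * \sum_(j <= i < n.+1) a i <=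
    \sum_(j <= i < n.+1) w i * a i + w j * \sum_(j <= i < n.+1) b i.
  case/andP=> j0 jn; elim: {j}(n - j) {-2}j (erefl (n - j)) j0 jn => [|k IH] j e j0 jn.
    have {e jn} -> : j = n by lia.
    by rewrite !big_nat1; lia.
  have jn' : j < n by lia.
  have ww : w j <= w j.+1 by apply: wmono.
  have := IH j.+1 _ isT jn'; have := sab j.+1 jn.
  rewrite !(@big_ltn _ _ _ j n.+1) //.
  move: (\sum_(j.+1 <= i < n.+1) w i * b i) (\sum_(j.+1 <= i < n.+1) w i * a i).
  move: (\sum_(j.+1 <= i < n.+1) a i) (\sum_(j.+1 <= i < n.+1) b i) => A B WB WA BA H.
  have {}H : WB + w j.+1 * A <= WA + w j.+1 * B by apply: H; lia.
  (* With these increments the step reduces to [d * c] being non-negative. *)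
  have [d ed] : exists d, w j.+1 = w j + d by exists (w j.+1 - w j); lia.
  have [c ec] : exists c, A = B + c by exists (A - B); lia.
  by rewrite ed ec in H *; nia.
have [->|n0] := posnP n; first by rewrite !big_geq.
have := abel 1; have := sab 1; rewrite n0 => /(_ isT) le /(_ isT).
have : w 1 * \sum_(1 <= i < n.+1) b i <= w 1 * \sum_(1 <= i < n.+1) a i.
  by rewrite leq_mul2l le orbT.
lia.
Qed.

(** * Comparison of the two trees *)

Lemma sum_drop (V : finType) (A : {set V}) (t : seq V) x0 (F : V -> nat) j :
  perm_eq t (enum A) ->
  \sum_(j <= i < size t) F (nth x0 t i) = \sum_(v in A :\: [set v in take j t]) F v.
Proof.
move=> pt; have ut : uniq t by rewrite (perm_uniq pt) enum_uniq.
transitivity (\sum_(v <- drop j t) F v).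
  rewrite (big_nth x0) size_drop -{1}[j]add0n big_addn.
  by apply: eq_bigr => i _; rewrite nth_drop addnC.
rewrite -big_enum; apply: perm_big; apply: uniq_perm; rewrite ?drop_uniq ?enum_uniq //.
move=> v; have mt : (v \in A) = (v \in take j t) || (v \in drop j t).
  by rewrite -mem_cat cat_take_drop (perm_mem pt) mem_enum.
rewrite mem_enum in_setD inE mt.
move: ut; rewrite -{1}(cat_take_drop j t) cat_uniq => /and3P[_ /hasPn h _].
case vd: (v \in drop j t); last by rewrite orbF andNb.
by rewrite (negbTE (h v vd)).
Qed.

Theorem theorem2p22 (D : seq nat) (r : nat)
  (hD : exists (V : finType) (T : graph V), is_tree T /\ degree_seq T = D)
  (hr : 0 < r) :
  [/\ is_tree (greedy_tree D),
      degree_seq (greedy_tree D) = D &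
      forall (V : finType) (T : graph V),
        is_tree T -> degree_seq T = D ->
        steiner_wiener r (greedy_tree D) <= steiner_wiener r T].
Proof.
have [n0 DN Dn Dpos Dsorted] : [/\ 0 < size D,
    forall i, 0 < i < size D -> i < num_labelled D i,
    num_labelled D (size D) = size D,
    forall i, 0 < i < size D -> 0 < nth 0 D i & sorted geq D].
  (* A rooting of some tree that realises [D] yields the numerical conditions needed to build the
     greedy tree. *)
  case: hD => V [T [/tree_centroid[rho [p [dep [R _]]]] <-]].
  rewrite size_degree_seq; split.
  - by apply/card_gt0P; exists rho; exact: (rooted_root R).
  - exact: (ltn_num_labelled R).
  - exact: (num_labelled_size R).
  - exact: (degree_seq_gt0 R).
  exact: degree_seq_sorted.
have RG := greedy_rooted n0 DN Dn.
split; first exact: (rooted_is_tree RG).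
  exact: (greedy_degree_seq n0 DN Dn Dpos Dsorted).
move=> V T /tree_centroid[rho [p [dep [R cen]]]] eD; rewrite -(prednK hr).
set n := size D; have nE : #|verts T| = n by rewrite -size_degree_seq eD.
pose x0 := greedy_root n0; pose q := @greedy_parent D.
pose s v := #|desc T rho p v|; pose sG v := #|desc (greedy_tree D) x0 q v|.
pose a i := s (nth rho (by_size T rho p) i).
pose b i := sG (nth x0 (enum 'I_n) i).
have szt : size (by_size T rho p) = n by rewrite size_by_size.
have pG : perm_eq (enum 'I_n) (enum (verts (greedy_tree D))).
  by rewrite verts_greedy enum_setT enumT.
have prefG j : [set v in take j (enum 'I_n)] = [set v : 'I_n | v < j].
  by apply/setP => v; rewrite !inE in_take ?mem_enum // index_enum_ord.
have suma (F : nat -> nat) j : \sum_(j <= i < n) F (a i) =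
    \sum_(v in verts T :\: prefix_set T rho p j) F (s v).
  by rewrite -szt (sum_drop rho (F \o s) j (perm_by_size T rho p)).
have sumb (F : nat -> nat) j : \sum_(j <= i < n) F (b i) =
    \sum_(v in verts (greedy_tree D) :\: [set v : 'I_n | v < j]) F (sG v).
  by rewrite -prefG -(sum_drop x0 (F \o sG) j pG) size_enum_ord.
(* Both suffix sums add up [n] minus layer sizes; the layers of [T] are bounded by the iterates of
   [num_labelled] that give the greedy ones. *)
have suff_le j : 0 < j <= n -> \sum_(j <= i < n) b i <= \sum_(j <= i < n) a i.
  case/andP=> j0 jn; rewrite (sumb id) (suma id).
  rewrite /sG verts_greedy greedy_sum_desc // /s sum_desc_layers nE.
  apply: leq_sum => k _; apply: leq_sub2l.
  have := card_layer R (prefix_sub T rho p j) (prefix_root R j0) (fun v => @prefix_closed _ _ _ _ _ R j v) k.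
  by rewrite eD card_prefix // nE.
(* Index 0 holds the centroid, so every other index obeys the centroid bound. *)
have an i : 0 < i < n -> 0 < a i /\ 2 * a i <= n.
  case/andP=> i0 iN; set v := nth rho (by_size T rho p) i.
  have hv : v \in verts T by rewrite -(mem_by_size T rho p) mem_nth // szt.
  have vr : v != rho.
    apply/eqP => e; have := index_root R; rewrite -{1}e index_uniq ?uniq_by_size ?szt //.
    by move=> ei; rewrite ei in i0.
  split; last by rewrite -nE; exact: cen.
  by apply/card_gt0P; exists v; exact: desc_refl.
have bn i : b i <= n.
  rewrite -[X in _ <= X]card_ord -cardsT -verts_greedy; apply: subset_leq_card.
  exact: desc_sub.
have adecr i : i.+1 < n -> a i.+1 <= a i.
  by move=> iN; have /sortedP := by_size_sorted T rho p; apply; rewrite szt.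
have W : \sum_(1 <= i < n) cut_slope n r.-1 (a i) * b i <=
         \sum_(1 <= i < n) cut_slope n r.-1 (a i) * a i.
  apply: weighted_suffix_sums => // i i0 iN.
  by apply: cut_slope_decr; apply: adecr.
have H : \sum_(1 <= i < n) bin_cut n r.-1.+1 (a i) <= \sum_(1 <= i < n) bin_cut n r.-1.+1 (b i).
  (* Supporting lines at [a i] are evaluated at [b i]; [W] then removes the linear terms. *)
  have : \sum_(1 <= i < n) (bin_cut n r.-1.+1 (a i) + cut_slope n r.-1 (a i) * a i) <=
         \sum_(1 <= i < n) (bin_cut n r.-1.+1 (b i) + cut_slope n r.-1 (a i) * b i).
    rewrite big_nat_cond [X in _ <= X]big_nat_cond; apply: leq_sum => i /andP[hi _].
    by have [h1 h2] := an i hi; apply: bin_cut_tangent.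
  by rewrite !big_split /=; lia.
have r0 : 0 < r.-1.+1 by [].
have := steiner_wienerE R r0; have := steiner_wienerE RG r0.
move: H; rewrite suma sumb (prefix1 R).
have -> : [set v : 'I_n | v < 1] = [set x0].
  by apply/setP => v; rewrite !inE ltnS leqn0 -val_eqE.
have nG : #|verts (greedy_tree D)| = n by rewrite verts_greedy cardsT card_ord.
rewrite nG nE !sum_nat_const (card_nonroot R) (card_nonroot RG) nG nE.
move=> le eG eT; have := leq_add (leqnn (steiner_wiener r.-1.+1 (greedy_tree D))) le.
by rewrite /bin_cut /s /sG /q /x0 eG -eT leq_add2r.
Qed.
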